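(* Let $b\geq 2$ be an integer and let $a$ be a real number with $0\leq a<1$. Let $T_{a,b}(x)=\sum_{n=0}^\infty a^n\phi(b^n x)$ for $x\in[0,1]$, where $\phi(x)=\mathrm{dist}(x,\mathbb{Z})$, and let $\mathcal{G}T_{a,b}=\{(x,T_{a,b}(x)):x\in[0,1]\}\subset\mathbb{R}^2$ be its graph. Then $$\dim_A\mathcal{G}T_{a,b}=1\quad\text{if and only if}\quad 0\leq a\leq b^{-1}.$$
   Context: $\phi(x)=\mathrm{dist}(x,\mathbb{Z})$ is the distance from the real number $x$ to the nearest integer; the convention $0^0=1$ is used. Assouad dimension: for a bounded set $E\subset\mathbb{R}^d$ and $\delta>0$, let $N_\delta(E)$ be the least number of open sets of diameter at most $\delta$ needed to cover $E$. Let $B(x,\rho)$ be the closed ball with center $x$ and radius $\rho$. For bounded $F\subset\mathbb{R}^d$, $\dim_A F$ is the infimum of all $\alpha>0$ for which there is a constant $C>0$ such that $N_r(B(x,R)\cap F)\leq C(R/r)^\alpha$ for all $0<r<R$ and all $x\in F$. *)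

(* Defs.v *)
From HB Require Import structures.
From mathcomp Require Import all_boot all_order all_algebra.
From mathcomp Require Import all_classical all_reals all_analysis.

Set Implicit Arguments.
Unset Strict Implicit.
Unset Printing Implicit Defensive.

Import Order.TTheory GRing.Theory Num.Theory.
Import numFieldNormedType.Exports.

Local Open Scope classical_set_scope.
Local Open Scope ring_scope.

(* The library norm on ['rV[R]_d] is the sup norm, hence the explicit Euclidean
   distance; both induce the product topology, which is the one behind [open]. *)
Definition eucl_dist (R : realType) (d : nat) (x y : 'rV[R]_d) : R :=
  Num.sqrt (\sum_(i < d) (x ord0 i - y ord0 i) ^+ 2).

Definition eucl_cball (R : realType) (d : nat) (x : 'rV[R]_d) (rho : R) :
    set 'rV[R]_d :=
  [set y | eucl_dist x y <= rho].

(* The diameter of the empty set is -oo, so that it is at most any real. *)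
Definition eucl_diam (R : realType) (d : nat) (A : set 'rV[R]_d) : \bar R :=
  ereal_sup [set (eucl_dist p.1 p.2)%:E | p in A `*` A].

Definition has_open_cover (R : realType) (d : nat) (delta : R)
    (E : set 'rV[R]_d) (n : nat) : Prop :=
  exists U : 'I_n -> set 'rV[R]_d,
    (forall i, open (U i) /\ (eucl_diam (U i) <= delta%:E)%E) /\
    E `<=` \bigcup_i U i.

(* Extended-real valued: +oo when there is no finite cover, which does not
   happen for bounded E and delta > 0. *)
Definition covering_number (R : realType) (d : nat) (delta : R)
    (E : set 'rV[R]_d) : \bar R :=
  ereal_inf [set (n%:R : R)%:E | n in has_open_cover delta E].

Definition assouad_dim (R : realType) (d : nat) (F : set 'rV[R]_d) : \bar R :=
  ereal_inf [set alpha%:E | alpha in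
    [set alpha : R | 0 < alpha /\
      exists C : R, 0 < C /\
        forall (r rho : R) (x : 'rV[R]_d), 0 < r -> r < rho -> F x ->
          (covering_number r (eucl_cball x rho `&` F)
             <= (C * (rho / r) `^ alpha)%:E)%E]].

Definition dist_to_int (R : realType) (x : R) : R :=
  inf [set `|x - m%:~R| | m in [set: int]].

(* For 0 <= a < 1 the series converges, so that the total [limn] is its sum. *)
Definition takagi (R : realType) (a : R) (b : nat) (x : R) : R :=
  limn (series (fun n => a ^+ n * dist_to_int (b%:R ^+ n * x))).

Definition takagi_graph (R : realType) (a : R) (b : nat) : set 'rV[R]_2 :=
  [set \row_(j < 2) [:: x; takagi a b x]`_j | x in `[0, 1]].

(* Main.v *)
Require Import Defs.
From HB Require Import structures.
From mathcomp Require Import all_boot all_order all_algebra.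
From mathcomp Require Import all_classical all_reals all_analysis.
From mathcomp Require Import zify ring lra.

(* Write T = S_n + a ^ n T (b ^ n .), with S_n the n-th partial sum.

   On a b-adic interval of level n, S_n is concave, and T = S_n at the end points,
   so T oscillates there by at least a ^ n / 2.  By the intermediate value theorem
   the graph then contains about (a b ^ 2) ^ n points that are b ^ -n / 2 separated,
   whence the dimension is at least ln (a b ^ 2) / ln b, which exceeds 1 if a b > 1.
   Separating by abscissa alone gives the lower bound 1 for every a.

   If a b <= 1, the difference of T at two points of a half b-adic interval of level
   n is s (x - y) + O(m |x - y| + b ^ -(n + m)) for all m, with s the slope of S_n.
   A ball of radius rho is then covered by O((1 + ln (rho / r)) rho / r) sets of
   diameter at most r, uniformly in s, and the logarithm does not affect the
   dimension. *)

Set Implicit Arguments.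
Unset Strict Implicit.
Unset Printing Implicit Defensive.

Import Order.TTheory GRing.Theory Num.Theory.
Import numFieldNormedType.Exports.

Local Open Scope classical_set_scope.
Local Open Scope ring_scope.

(** * The distance to the nearest integer *)

Lemma dist_to_int_le (R : realType) (x : R) (m : int) :
  dist_to_int x <= `|x - m%:~R|.
Proof.
apply: ge_inf; last by exists m.
by exists 0 => _ [k _ <-].
Qed.

Lemma le_dist_to_int (R : realType) (x c : R) :
  (forall m : int, c <= `|x - m%:~R|) -> c <= dist_to_int x.
Proof.
move=> h; apply: lb_le_inf; first by exists `|x - 0%:~R|; exists 0.
by move=> _ [k _ <-].
Qed.

Lemma dist_to_int_ge0 (R : realType) (x : R) : 0 <= dist_to_int x.
Proof. exact: le_dist_to_int. Qed.

Lemma dist_to_intE (R : realType) (x : R) (m : int) :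
  m%:~R <= x <= m%:~R + 1 ->
  dist_to_int x = Num.min (x - m%:~R) (m%:~R + 1 - x).
Proof.
move=> /andP[mx xm]; apply/eqP; rewrite eq_le; apply/andP; split.
  rewrite le_min; apply/andP; split.
    by rewrite (le_trans (dist_to_int_le x m))// ger0_norm ?subr_ge0.
  rewrite (le_trans (dist_to_int_le x (m + 1)))// distrC intrD ger0_norm//.
  by rewrite subr_ge0.
apply: le_dist_to_int => k; rewrite ge_min; case: (lerP k m) => km.
  apply/orP; left; have : k%:~R <= m%:~R :> R by rewrite ler_int.
  by have := ler_norm (x - k%:~R); lra.
apply/orP; right; have : (m + 1)%:~R <= k%:~R :> R by rewrite ler_int lezD1.
by rewrite intrD distrC; have := ler_norm (k%:~R - x); lra.
Qed.

Lemma dist_to_int_le_half (R : realType) (x : R) : dist_to_int x <= 2^-1.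
Proof.
have /andP[h1 h2] := floor_itv x; rewrite intrD in h2.
rewrite (@dist_to_intE _ _ (Num.floor x)); last by rewrite h1 ltW.
by rewrite ge_min; case: (lerP (x - (Num.floor x)%:~R) 2^-1) => //=; lra.
Qed.

Lemma dist_to_int_int (R : realType) (m : int) : dist_to_int (m%:~R : R) = 0.
Proof.
apply/le_anti; rewrite dist_to_int_ge0 (le_trans (dist_to_int_le _ m))//.
by rewrite subrr normr0.
Qed.

Lemma dist_to_int_half_add (R : realType) (m : int) :
  dist_to_int (m%:~R + 2^-1 : R) = 2^-1.
Proof.
rewrite (@dist_to_intE _ _ m); last by apply/andP; split; lra.
by rewrite (_ : m%:~R + 2^-1 - m%:~R = 2^-1) ; [apply/min_idPl|]; lra.
Qed.

Lemma dist_to_int_lipschitz (R : realType) (x y : R) :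
  `|dist_to_int x - dist_to_int y| <= `|x - y|.
Proof.
have h (u v : R) : dist_to_int u - `|u - v| <= dist_to_int v.
  apply: le_dist_to_int => m; rewrite lerBlDr.
  apply: le_trans (dist_to_int_le u m) _.
  rewrite [leRHS]addrC; apply: le_trans (ler_normD _ _).
  by rewrite (_ : u - v + (v - m%:~R) = u - m%:~R)//; ring.
by have := h x y; have := h y x; rewrite (distrC y x) ler_norml; lra.
Qed.

(** Between consecutive integers the function is a minimum of two affine functions. *)
Lemma dist_to_int_concave (R : realType) (m : int) (x y : R) :
  m%:~R <= x <= m%:~R + 1 -> m%:~R <= y <= m%:~R + 1 ->
  dist_to_int x + dist_to_int y <= 2 * dist_to_int ((x + y) / 2).
Proof.
move=> hx hy; have hxy : m%:~R <= (x + y) / 2 <= m%:~R + 1 by lra.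
rewrite !(@dist_to_intE _ _ m)//.
have [] := lerP ((x + y) / 2 - m%:~R) (m%:~R + 1 - (x + y) / 2) => _.
  have h (u : R) : Num.min (u - m%:~R) (m%:~R + 1 - u) <= u - m%:~R.
    by rewrite ge_min lexx.
  by have := h x; have := h y; lra.
have h (u : R) : Num.min (u - m%:~R) (m%:~R + 1 - u) <= m%:~R + 1 - u.
  by rewrite ge_min lexx orbT.
by have := h x; have := h y; lra.
Qed.

(** The slope changes only at multiples of 1/2: it is 1 for even [i] and -1 for odd [i]. Labelling
    the half-open pieces by a floor makes them a partition of the line. *)
Lemma dist_to_int_affine (R : realType) (i : int) : exists s : R, forall u v,
  Num.floor (2 * u) = i -> Num.floor (2 * v) = i ->
  dist_to_int u - dist_to_int v = s * (u - v).
Proof.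
have [m [e [-> e01]]] : exists m e : int, i = m * 2 + e /\ (e = 0 \/ e = 1).
  by exists (i %/ 2)%Z, (i %% 2)%Z; lia.
exists (if e == 0 then 1 else -1).
have h (u : R) : Num.floor (2 * u) = m * 2 + e -> dist_to_int u =
  if e == 0 then u - m%:~R else m%:~R + 1 - u.
  move=> hu; have := floor_itv (2 * u); rewrite hu !intrD intrM -[2%:~R]/2%:R.
  case: e01 => -> hi; rewrite (@dist_to_intE _ _ m) /=; try lra.
    by apply/min_idPl; lra.
  by apply/min_idPr; lra.
by move=> u v /h -> /h ->; case: ifP => _; ring.
Qed.

(** * Partial sums, the functional equation and the modulus of continuity *)

Definition takagi_psum (R : realType) (a : R) (b n : nat) (x : R) : R :=
  \sum_(k < n) a ^+ k * dist_to_int (b%:R ^+ k * x).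

Section takagi_theory.
Context (R : realType) (a : R) (b : nat).
Hypotheses (a_ge0 : 0 <= a) (a_lt1 : a < 1).
Local Notation S := (takagi_psum a b).
Local Notation T := (takagi a b).

Lemma takagi_psumE x :
  series (fun k => a ^+ k * dist_to_int (b%:R ^+ k * x)) = S ^~ x.
Proof. by apply/funext => n; rewrite /series/= big_mkord. Qed.

Lemma takagi_psum0 x : S 0 x = 0.
Proof. by rewrite /takagi_psum big_ord0. Qed.

Lemma takagi_psumS n x : S n.+1 x = dist_to_int x + a * S n (b%:R * x).
Proof.
rewrite /takagi_psum big_ord_recl/= !expr0 !mul1r; congr (_ + _).
rewrite big_distrr; apply: eq_bigr => k _ /=.
by rewrite mulrA -exprS /bump/= add1n [b%:R ^+ k.+1]exprSr -mulrA.
Qed.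

Lemma takagi_psum_ge0 n x : 0 <= S n x.
Proof.
by apply: sumr_ge0 => k _; rewrite mulr_ge0 ?exprn_ge0 ?dist_to_int_ge0.
Qed.

(** The bound is the fixed point of c = 1/2 + a c, so [takagi_psumS] preserves it. *)
Lemma takagi_psum_le n x : S n x <= 2^-1 / (1 - a).
Proof.
elim: n x => [x|n IH x].
  by rewrite takagi_psum0 divr_ge0// subr_ge0 ltW.
rewrite takagi_psumS (_ : 2^-1 / (1 - a) = 2^-1 + a * (2^-1 / (1 - a))).
  by rewrite lerD ?dist_to_int_le_half ?ler_wpM2l.
by field; rewrite subr_eq0 gt_eqF.
Qed.

Lemma cvg_takagi_psum x : S ^~ x @ \oo --> T x.
Proof.
have -> : T x = limn (S ^~ x) by rewrite /takagi takagi_psumE.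
apply: nondecreasing_is_cvgn.
  apply/nondecreasing_seqP => n; rewrite /takagi_psum big_ord_recr/= lerDl.
  by rewrite mulr_ge0 ?exprn_ge0 ?dist_to_int_ge0.
by exists (2^-1 / (1 - a)) => _ [n _ <-]; exact: takagi_psum_le.
Qed.

Arguments cvg_takagi_psum : clear implicits.

Lemma takagi_ge0 x : 0 <= T x.
Proof.
apply: (cvgr_to_ge (cvg_takagi_psum x)).
by near=> n; exact: takagi_psum_ge0.
Unshelve. all: by end_near. Qed.

Lemma takagi_le x : T x <= 2^-1 / (1 - a).
Proof.
apply: (cvgr_to_le (cvg_takagi_psum x)).
by near=> n; exact: takagi_psum_le.
Unshelve. all: by end_near. Qed.

Lemma takagi_eq1 x : T x = dist_to_int x + a * T (b%:R * x).
Proof.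
have h : S ^~ x \o succn @ \oo --> dist_to_int x + a * T (b%:R * x).
  rewrite (_ : _ \o _ = fun n => dist_to_int x + a * S n (b%:R * x)).
    by apply: cvgD; [exact: cvg_cst | apply: cvgZr; exact: cvg_takagi_psum].
  by apply/funext => n /=; rewrite takagi_psumS.
apply: (@cvg_unique _ (@Rhausdorff R) _ _ _ _ _ h).
by have := cvg_takagi_psum x; rewrite -cvg_shiftS.
Qed.

Lemma takagi_eq n x : T x = S n x + a ^+ n * T (b%:R ^+ n * x).
Proof.
elim: n x => [x|n IH x]; first by rewrite takagi_psum0 !expr0 !mul1r add0r.
rewrite takagi_eq1 IH takagi_psumS mulrDr addrA.
by rewrite exprS -mulrA exprSr -[b%:R ^+ n * b%:R * x]mulrA.
Qed.

Lemma takagi_int (m : int) : T m%:~R = 0.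
Proof.
apply: (cvg_unique (@Rhausdorff R) (cvg_takagi_psum m%:~R)).
rewrite (_ : S ^~ m%:~R = cst 0); first exact: cvg_cst.
apply/funext => n; rewrite /takagi_psum big1// => k _.
rewrite (_ : b%:R ^+ k * m%:~R = (b%:Z ^+ k * m)%:~R) ?dist_to_int_int ?mulr0//.
by rewrite intrM rmorphXn.
Qed.

Lemma takagi_half_add (m : int) : 2^-1 <= T (m%:~R + 2^-1).
Proof.
by rewrite takagi_eq1 dist_to_int_half_add lerDl mulr_ge0// takagi_ge0.
Qed.

Lemma takagi_dist_le x y : `|T x - T y| <= 2^-1 / (1 - a).
Proof.
have := takagi_ge0 x; have := takagi_ge0 y; have := takagi_le x.
by have := takagi_le y; rewrite ler_norml; lra.
Qed.

Lemma takagi_psum_lipschitz n x y :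
  `|S n x - S n y| <= (\sum_(k < n) (a * b%:R) ^+ k) * `|x - y|.
Proof.
rewrite /takagi_psum -sumrB mulr_suml; apply: (le_trans (ler_norm_sum _ _ _)).
apply: ler_sum => k _; rewrite -mulrBr normrM ger0_norm ?exprn_ge0// exprMn.
rewrite -mulrA ler_wpM2l ?exprn_ge0//.
apply: le_trans (dist_to_int_lipschitz _ _) _.
by rewrite -mulrBr normrM ger0_norm ?exprn_ge0.
Qed.

(** The free [n] trades the Lipschitz constant of the partial sum against the size of the tail:
    continuity takes [n] large, while [takagi_cell] adapts it to the scale. *)
Lemma takagi_modulus n x y :
  `|T x - T y| <= (\sum_(k < n) (a * b%:R) ^+ k) * `|x - y|
                  + a ^+ n * (2^-1 / (1 - a)).
Proof.
rewrite (takagi_eq n x) (takagi_eq n y) opprD addrACA -mulrBr.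
apply: (le_trans (ler_normD _ _)); apply: lerD; first exact: takagi_psum_lipschitz.
by rewrite normrM ger0_norm ?exprn_ge0// ler_wpM2l ?exprn_ge0 ?takagi_dist_le.
Qed.

Lemma takagi_continuous : continuous T.
Proof.
move=> x; apply/cvgrPdist_lt => /= e e0.
have B0 : 0 < 2^-1 / (1 - a) by rewrite divr_gt0// subr_gt0.
have := @cvg_geometric R (2^-1 / (1 - a)) a; rewrite ger0_norm// => /(_ a_lt1).
move=> /cvgrPdist_lt/(_ (e / 2)); rewrite divr_gt0// => /(_ isT)[n _].
move=> /(_ n (leqnn _)).
rewrite /= sub0r normrN ger0_norm; last by rewrite mulr_ge0 ?exprn_ge0// ltW.
rewrite mulrC => hn.
set L := \sum_(k < n) (a * b%:R) ^+ k.
have L0 : 0 <= L by apply: sumr_ge0 => k _; rewrite exprn_ge0// mulr_ge0.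
near=> y.
apply: le_lt_trans (takagi_modulus n _ _) _.
suff : L * `|x - y| <= e / 2 by rewrite /L; lra.
(* [L] may vanish; [L + 1] is positive and can be divided by. *)
apply: (@le_trans _ _ ((L + 1) * `|x - y|)).
  by rewrite ler_wpM2r// lerDl.
rewrite mulrC -ler_pdivlMr; last lra.
near: y; apply: cvgr_dist_le => //=.
by rewrite divr_gt0//; lra.
Unshelve. all: by end_near. Qed.

(** * Behaviour on b-adic intervals *)

Lemma natr_expB k n : (0 < b)%N -> (k <= n)%N ->
  b%:R ^+ k = b%:R ^+ n / (b ^ (n - k))%:R :> R.
Proof.
move=> b0 kn; have bR : b%:R != 0 :> R by rewrite pnatr_eq0 -lt0n.
by apply: (canRL (mulfK _)); rewrite natrX ?expf_neq0// -exprD subnKC.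
Qed.

(* The convex kinks of the distance to the integers are the integers, so none of
   those of the partial sum lies inside a [b]-adic interval of level [n]. *)
Lemma takagi_psum_concave n (j : int) x y : (0 < b)%N ->
  j%:~R <= b%:R ^+ n * x <= j%:~R + 1 ->
  j%:~R <= b%:R ^+ n * y <= j%:~R + 1 ->
  S n x + S n y <= 2 * S n ((x + y) / 2).
Proof.
move=> b0 hx hy; rewrite /takagi_psum -big_split mulr_sumr.
apply: ler_sum => k _ /=.
rewrite -mulrDr mulrCA ler_wpM2l ?exprn_ge0//.
rewrite mulrA mulrDr; set d := (b ^ (n - k))%N.
have d0 : (0 : R) < d%:R by rewrite ltr0n expn_gt0 b0.
have dZ : (0 : int) < d%:Z by rewrite ltz_nat expn_gt0 b0.
(* A b-adic interval of level [n] lies inside one of the coarser level [k], whose number is the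
   integer quotient of [j] by [d]. *)
have hd (z : R) : j%:~R <= b%:R ^+ n * z <= j%:~R + 1 ->
  (j %/ d)%Z%:~R <= b%:R ^+ k * z <= (j %/ d)%Z%:~R + 1.
  move=> /andP[jz zj].
  rewrite (natr_expB b0 (ltnW (ltn_ord k))) -/d mulrAC ler_pdivlMr// ler_pdivrMr//.
  apply/andP; split.
    apply: le_trans jz; rewrite -[d%:R]/(d%:Z%:~R) -intrM ler_int.
    by rewrite lez_floor// gt_eqF.
  apply: (le_trans zj); rewrite -[d%:R]/(d%:Z%:~R) -[1]/(1%:~R).
  by rewrite -!intrD -intrM ler_int lezD1 ltz_ceil.
exact: (dist_to_int_concave (hd _ hx) (hd _ hy)).
Qed.

(** The tail a^n T(b^n .) vanishes at the end points, which [b%:R ^+ n] sends to integers, and is at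
    least a^n / 2 at the midpoint, sent to a half-integer. Concavity handles the partial sum. *)
Lemma takagi_mid n (j : int) x y : (0 < b)%N ->
  b%:R ^+ n * x = j%:~R -> b%:R ^+ n * y = j%:~R + 1 ->
  T x + T y + a ^+ n <= 2 * T ((x + y) / 2).
Proof.
move=> b0 hx hy.
have : S n x + S n y <= 2 * S n ((x + y) / 2).
  by apply: (@takagi_psum_concave n j) => //; rewrite ?hx ?hy lexx lerDl ler01.
rewrite (takagi_eq n x) (takagi_eq n y) (takagi_eq n ((x + y) / 2)).
have -> : b%:R ^+ n * ((x + y) / 2) = j%:~R + 2^-1.
  by rewrite mulrA mulrDr hx hy; field.
have T1 : T (j%:~R + 1) = 0 by rewrite -(takagi_int (j + 1)) intrD.
rewrite hx hy T1 takagi_int.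
by have := ler_wpM2l (exprn_ge0 n a_ge0) (takagi_half_add j); lra.
Qed.

(* For odd [b] the concave kinks, at the half-integers, are not [b]-adic; hence
   intervals of length [1 / (2 b ^ n)]. *)
Lemma takagi_psum_affine n (j : int) : (0 < b)%N -> exists s : R, forall x y,
  Num.floor (2 * (b%:R ^+ n * x)) = j -> Num.floor (2 * (b%:R ^+ n * y)) = j ->
  S n x - S n y = s * (x - y).
Proof.
move=> b0.
have /choice[s hs] : forall k : 'I_n, exists s : R, forall x y,
  Num.floor (2 * (b%:R ^+ n * x)) = j -> Num.floor (2 * (b%:R ^+ n * y)) = j ->
  a ^+ k * dist_to_int (b%:R ^+ k * x) - a ^+ k * dist_to_int (b%:R ^+ k * y) =
  s * (x - y).
  move=> k; set d := (b ^ (n - k))%N.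
  have d0 : (0 : R) < d%:R by rewrite ltr0n expn_gt0 b0.
  have dZ : (0 : int) < d%:Z by rewrite ltz_nat expn_gt0 b0.
  have [s hs] := dist_to_int_affine R (j %/ d)%Z.
  exists (a ^+ k * s * b%:R ^+ k) => x y hx hy.
  have hd (z : R) : Num.floor (2 * (b%:R ^+ n * z)) = j ->
    Num.floor (2 * (b%:R ^+ k * z)) = (j %/ d)%Z.
    move=> hz; have /andP[jz zj] := floor_itv (2 * (b%:R ^+ n * z)).
    rewrite hz in jz zj; apply: floor_def.
    rewrite mulrCA (natr_expB b0 (ltnW (ltn_ord k))) -/d mulrAC.
    rewrite [b%:R ^+ n * _]mulrCA ler_pdivlMr// ltr_pdivrMr//; apply/andP; split.
      apply: le_trans jz; rewrite -[d%:R]/(d%:Z%:~R) -intrM ler_int.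
      by rewrite lez_floor// gt_eqF.
    apply: (lt_le_trans zj); rewrite -[d%:R]/(d%:Z%:~R) -intrM ler_int.
    by rewrite lezD1 ltz_ceil.
  by rewrite -mulrBr (hs _ _ (hd _ hx) (hd _ hy)); ring.
exists (\sum_k s k) => x y hx hy.
by rewrite /takagi_psum -sumrB mulr_suml; apply: eq_bigr => k _; exact: hs.
Qed.

(** Once the affine part is removed, only a^n (T(b^n x) - T(b^n y)) is left. [takagi_modulus] with
    [m] terms bounds it, each term having Lipschitz constant at most 1 because a b <= 1. The slope
    is chosen before [m], so that one [s] serves several [m]. *)
Lemma takagi_cell n (j : int) : (2 <= b)%N -> a <= b%:R^-1 ->
  exists s : R, forall (m : nat) x y,
    Num.floor (2 * (b%:R ^+ n * x)) = j -> Num.floor (2 * (b%:R ^+ n * y)) = j ->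
    `|T x - T y - s * (x - y)| <= m%:R * `|x - y| + b%:R^-1 ^+ (n + m).
Proof.
move=> b2 ab; have b0 : (0 < b)%N by lia.
have bR : (2 : R) <= b%:R by rewrite ler_nat.
have ab1 : a * b%:R <= 1 by rewrite -ler_pdivlMr ?div1r//; lra.
(* This makes the constant 1 / (2 (1 - a)) of the tail at most 1. *)
have a2 : a <= 2^-1 by apply: le_trans ab _; rewrite lef_pV2 ?posrE//; lra.
have [s hs] := takagi_psum_affine n j b0; exists s => m x y hx hy.
rewrite (takagi_eq n x) (takagi_eq n y) opprD addrACA -mulrBr (hs x y)//.
rewrite addrAC subrr add0r normrM ger0_norm ?exprn_ge0//.
apply: (@le_trans _ _ (a ^+ n * (m%:R * (b%:R ^+ n * `|x - y|) + a ^+ m))).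
  rewrite ler_wpM2l ?exprn_ge0//; apply: le_trans (takagi_modulus m _ _) _.
  apply: lerD.
    rewrite -mulrBr normrM ger0_norm ?exprn_ge0// ler_wpM2r ?mulr_ge0 ?exprn_ge0//.
    rewrite -[m in leRHS]card_ord -sum1_card natr_sum; apply: ler_sum => k _.
    by rewrite exprn_ile1// mulr_ge0.
  rewrite -[leRHS]mulr1 ler_wpM2l ?exprn_ge0// ler_pdivrMr ?mul1r; lra.
rewrite mulrDr -exprD; apply: lerD.
  by rewrite mulrCA ler_wpM2l// mulrA -exprMn ler_piMl// exprn_ile1// mulr_ge0.
by rewrite lerXn2r// nnegrE invr_ge0; lra.
Qed.

End takagi_theory.

(** * Powers, logarithms and integer estimates *)

Lemma ltn_uphalf i N : (i < N.+1./2 -> 2 * i < N)%N.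
Proof. by lia. Qed.

Section powers.
Context (R : realType).

Lemma exists_expr_gt (q K : R) : 1 < q -> exists n, K < q ^+ n.
Proof.
move=> q1; have q0 : 0 < q by lra.
have K0 : 0 < `|K| + 1 by rewrite ltr_wpDl.
have /cvgrPdist_lt/(_ (`|K| + 1)^-1) : (GRing.exp q^-1 : R ^nat) @ \oo --> 0.
  by apply: cvg_expr; rewrite ger0_norm ?invr_ge0 ?ltW// invf_lt1.
rewrite invr_gt0 K0 => /(_ isT)[n _ /(_ n (leqnn _))] /=.
rewrite sub0r normrN ger0_norm ?exprn_ge0 ?invr_ge0 ?ltW// exprVn.
rewrite ltf_pV2 ?posrE ?exprn_gt0// => h; exists n.
by have := ler_norm K; lra.
Qed.

(** The least exponent works. If it is 0 there is no smaller power to compare with, hence the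
    alternative. *)
Lemma expr_bracket (q K : R) : 1 < q -> 0 < K ->
  exists n, K <= q ^+ n /\ (n = 0%N \/ q ^+ n < q * K).
Proof.
move=> q1 K0; have [n0 hn0] := exists_expr_gt K q1.
have ex : exists n, K <= q ^+ n by exists n0; exact: ltW.
exists (ex_minn ex); case: ex_minnP => -[|n] hn min; split=> //; first by left.
right; rewrite exprS ltr_pM2l ?ltNge; last lra.
by apply/negP => /min; rewrite ltnn.
Qed.

Lemma bernoulli_ineq (x : R) n : 0 <= x -> 1 + n%:R * x <= (1 + x) ^+ n.
Proof.
move=> x0; elim: n => [|n IH]; first by rewrite expr0; lra.
rewrite exprS -natr1; have := ler_wpM2l (addr_ge0 ler01 x0) IH.
have : 0 <= n%:R * x * x by rewrite !mulr_ge0.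
lra.
Qed.

(** Here [m] is at most 1 + log_q t, and [2 * m%:R + 19] is the column count of
    [takagi_graph_cover]. Writing q^eps = 1 + x, Bernoulli's inequality bounds 1 + m x by (q^m)^eps,
    hence by (q t)^eps. *)
Lemma log_le_powR (q eps : R) : 1 < q -> 0 < eps -> exists2 C : R, 0 < C &
  forall (m : nat) t, 0 < t -> q ^+ m <= q * t -> 2 * m%:R + 19 <= C * t `^ eps.
Proof.
move=> q1 e0; have q0 : 0 < q by lra.
have qe1 : 1 < q `^ eps.
  by rewrite /powR gt_eqF// expR_gt1 mulr_gt0// ln_gt0.
pose x := q `^ eps - 1; have x0 : 0 < x by rewrite /x; lra.
exists ((19 + 2 / x) * q `^ eps) => [|m t t0 h].
  by rewrite mulr_gt0 ?addr_gt0 ?divr_gt0//; lra.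
rewrite -mulrA -(powRM _ (ltW q0) (ltW t0)).
apply: (@le_trans _ _ ((19 + 2 / x) * (1 + m%:R * x))).
  rewrite (_ : _ * (1 + m%:R * x) =
    2 * m%:R + 19 + (2 / x + 19 * (m%:R * x))).
    by rewrite lerDl addr_ge0 ?divr_ge0 ?mulr_ge0// ltW.
  by field; rewrite gt_eqF.
rewrite ler_pM2l; last by rewrite addr_gt0// divr_gt0.
apply: le_trans (bernoulli_ineq m (ltW x0)) _; rewrite /x addrC subrK.
rewrite -powR_mulrn ?powR_ge0// -powRrM mulrC powRrM (powR_mulrn _ (ltW q0)).
have := (ltW e0, ltW q0, ltW t0) => -[[e0' q0'] t0'].
by apply: ge0_ler_powR; rewrite ?nnegrE ?exprn_ge0 ?mulr_ge0.
Qed.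

Lemma ler_nat_dist1 (i j : nat) : i != j -> 1 <= `|i%:R - j%:R| :> R.
Proof.
move=> ij; rewrite -[i%:R]/(i%:Z%:~R) -[j%:R]/(j%:Z%:~R) -intrB -intr_norm.
by rewrite -[1]/(1%:~R) ler_int; lia.
Qed.

(** Distinct unit intervals starting at even integers are at least 1 apart. *)
Lemma ler_double (i j : nat) : (i < j)%N -> (2 * i)%:R + 2 <= (2 * j)%:R :> R.
Proof. by move=> ij; rewrite -natrD ler_nat; lia. Qed.

Lemma half_le_uphalf N : N%:R / 2 <= (N.+1./2)%:R :> R.
Proof. by rewrite ler_pdivrMr// -natrM ler_nat; lia. Qed.

Lemma intr_norm_lt1 (z : int) : `|z%:~R : R| < 1 -> z = 0.
Proof. by rewrite -intr_norm -[1]/(1%:~R) ltr_int; lia. Qed.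

End powers.

(** * Open covers, separated sets and the Assouad dimension *)

Section covering.
Context (R : realType) (d : nat).
Implicit Types (x y : 'rV[R]_d) (E : set 'rV[R]_d) (r : R).

Lemma eucl_dist_ge_coord x y i : `|x ord0 i - y ord0 i| <= eucl_dist x y.
Proof.
rewrite -sqrtr_sqr ler_wsqrtr// (bigD1 i)//= lerDl.
by apply: sumr_ge0 => j _; exact: sqr_ge0.
Qed.

Lemma eucl_dist_le_sum x y :
  eucl_dist x y <= \sum_(i < d) `|x ord0 i - y ord0 i|.
Proof.
have [s0 s1] : 0 <= \sum_(i < d) `|x ord0 i - y ord0 i| /\
    \sum_(i < d) (x ord0 i - y ord0 i) ^+ 2 <=
    (\sum_(i < d) `|x ord0 i - y ord0 i|) ^+ 2.
  apply: (big_ind2 (fun u v : R => 0 <= u /\ v <= u ^+ 2)).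
  - by rewrite expr0n.
  - move=> u v u' v' [u0 uv] [u0' uv']; split; first exact: addr_ge0.
    by rewrite sqrrD; nra.
  - by move=> i _; rewrite real_normK ?num_real.
by rewrite -[leRHS]ger0_norm// -sqrtr_sqr ler_wsqrtr.
Qed.

Lemma eucl_diam_leP E r :
  (eucl_diam E <= r%:E)%E <-> forall x y, E x -> E y -> eucl_dist x y <= r.
Proof.
split=> [h x y Ex Ey|h].
  rewrite -lee_fin; apply: le_trans h; apply: ereal_sup_ubound.
  by exists (x, y).
by apply: ge_ereal_sup => _ [[x y] [/= Ex Ey] <-]; rewrite lee_fin h.
Qed.

Lemma has_open_cover_finType r E (I : finType) (U : I -> set 'rV[R]_d) :
  (forall i, open (U i)) -> (forall i, (eucl_diam (U i) <= r%:E)%E) ->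
  E `<=` \bigcup_i U i -> has_open_cover r E #|I|.
Proof.
move=> oU dU EU; exists (fun k => U (enum_val k)); split=> [k|x /EU[i _ Uix]].
  by split.
by exists (enum_rank i) => //; rewrite enum_rankK.
Qed.

Lemma has_open_cover0 r n : has_open_cover r (set0 : set 'rV[R]_d) n.
Proof.
exists (fun=> set0); split=> // i; split; first exact: open0.
by apply/eucl_diam_leP.
Qed.

Lemma has_open_cover1 r E : 0 < r ->
  (forall x y, E x -> E y -> \sum_(i < d) `|x ord0 i - y ord0 i| <= r / 2) ->
  has_open_cover r E 1.
Proof.
(* Thickening by sup-norm balls of radius [e] adds 2 e per coordinate, hence at most r / 2 in all;
   [d.+1] keeps the denominator positive when [d] is 0. *)
move=> r0 hE; pose e : R := r / (4 * d.+1%:R).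
have e0 : 0 < e by rewrite divr_gt0// mulr_gt0.
exists (fun=> \bigcup_(x in E) ball x e); split=> [_|x Ex]; last first.
  by exists ord0 => //; exists x => //; exact: ballxx.
split; first by apply: bigcup_open => x _; exact: ball_open.
apply/eucl_diam_leP => u v [x Ex xu] [y Ey yv].
apply: (le_trans (eucl_dist_le_sum _ _)).
apply: (@le_trans _ _ (\sum_(i < d) (`|x ord0 i - y ord0 i| + 2 * e))).
  apply: ler_sum => i _.
  have := xu; have := yv; rewrite /ball/= => [[_ /(_ ord0 i) h1]] [_ /(_ ord0 i) h2].
  move: h1 h2; rewrite /ball/=.
  rewrite !ltr_norml -[leLHS]/(`|_|) => /andP[? ?] /andP[? ?].
  have := ler_norm (x ord0 i - y ord0 i).
  have := ler_norm (- (x ord0 i - y ord0 i)); rewrite normrN.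
  by rewrite ler_norml; lra.
rewrite big_split/= sumr_const card_ord.
have := hE x y Ex Ey; have : (2 * e) *+ d <= r / 2; last lra.
rewrite -mulr_natr /e.
have : (d%:R : R) <= d.+1%:R by rewrite ler_nat.
have dp : (0 : R) < d.+1%:R by rewrite ltr0n.
rewrite (_ : 2 * (r / (4 * d.+1%:R)) * d%:R = r / 2 * (d%:R / d.+1%:R)).
  by move=> h; rewrite ler_piMr ?ler_pdivrMr ?mul1r//; lra.
by field; rewrite nat1r gt_eqF.
Qed.

(** Cut [E] along the values of [f] relative to a base point, in steps of [h]: the labels run from
    -N to N. The graph is cut three times this way: by cell, by abscissa, by ordinate. *)
Lemma has_open_cover_slices r (h : R) E (f : 'rV[R]_d -> R) (N M : nat) : 0 < h ->
  (forall x y, E x -> E y -> `|f x - f y| <= N%:R * h) ->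
  (forall E', E' `<=` E -> (forall x y, E' x -> E' y -> `|f x - f y| <= h) ->
    has_open_cover r E' M) ->
  has_open_cover r E ((2 * N).+1 * M).
Proof.
move=> h0 hE hM.
have [->|/set0P[x0 Ex0]] := eqVneq E set0; first exact: has_open_cover0.
pose lab x : int := Num.floor ((f x - f x0) / h).
pose Es (k : 'I_(2 * N).+1) := E `&` [set x | lab x + N%:Z = k%:Z].
have /choice[U hU] : forall k, has_open_cover r (Es k) M.
  move=> k; apply: hM => [x [] //|x y [Ex hx] [Ey hy]].
  have xy : lab x = lab y by move: hx hy => /=; lia.
  have := floor_itv ((f x - f x0) / h); have := floor_itv ((f y - f x0) / h).
  rewrite -/(lab x) -/(lab y) xy intrD => /andP[a1 a2] /andP[a3 a4].
  rewrite -[leRHS]mul1r -ler_pdivrMr// -[h in X in X <= _](gtr0_norm h0) -normf_div.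
  rewrite (_ : (f x - f y) / h = (f x - f x0) / h - (f y - f x0) / h); last by ring.
  by rewrite ler_norml; lra.
rewrite -[in X in has_open_cover _ _ X](card_ord (2 * N).+1) -[M]card_ord -card_prod.
apply: (@has_open_cover_finType _ _ _ (fun k => U k.1 k.2)).
- by move=> [k i] /=; case: (hU k) => /(_ i)[].
- by move=> [k i] /=; case: (hU k) => /(_ i)[].
move=> x Ex.
have : `|(f x - f x0) / h| <= N%:R.
  by rewrite normf_div (gtr0_norm h0) ler_pdivrMr// hE.
rewrite ler_norml => /andP[l1 l2].
have lx1 : - N%:Z <= lab x by rewrite floor_ge_int mulrNz.
have lx2 : lab x <= N%:Z.
  by rewrite -(ler_int R); apply: le_trans l2; exact: floor_le.
have kN : (absz (lab x + N%:Z)%R < (2 * N).+1)%N by lia.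
have [_ /(_ x)] := hU (Ordinal kN); case; first by split=> //=; lia.
by move=> i _ Ux; exists (Ordinal kN, i).
Qed.

(** Pigeonhole: a set of diameter at most [r] holds at most one of the points. *)
Lemma leq_card_separated r E (I : finType) (g : I -> 'rV[R]_d) n :
  (forall i, E (g i)) -> (forall i j, i != j -> r < eucl_dist (g i) (g j)) ->
  has_open_cover r E n -> (#|I| <= n)%N.
Proof.
move=> gE gr [U [hU EU]].
have /choice[k hk] : forall i, exists k, U k (g i).
  by move=> i; have [k _ ?] := EU _ (gE i); exists k.
rewrite -[n]card_ord; apply: (leq_card k) => i j kij.
apply/eqP; apply: contraT => /gr; rewrite ltNge => /negP[].
have [_ /eucl_diam_leP] := hU (k i); apply; first exact: hk.
by rewrite kij.
Qed.

Lemma covering_number_le r E n :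
  has_open_cover r E n -> (covering_number r E <= (n%:R : R)%:E)%E.
Proof. by move=> h; apply: ereal_inf_lbound; exists n. Qed.

Definition assouad_exponent (F : set 'rV[R]_d) (alpha : R) : Prop :=
  0 < alpha /\ exists C : R, 0 < C /\
    forall (r rho : R) (x : 'rV[R]_d), 0 < r -> r < rho -> F x ->
      (covering_number r (eucl_cball x rho `&` F)
        <= (C * (rho / r) `^ alpha)%:E)%E.

(** At the scale b^-n / 2, in a fixed ball containing [F], the definition gives c g^n <= C (2 rho
    b^n)^alpha for every [n]; this fails for large [n] if g > b^alpha. *)
Lemma assouad_exponent_separated (F : set 'rV[R]_d) (alpha b g c rho : R) x0 :
  1 < b -> 0 < c -> 1 <= rho -> F x0 -> F `<=` eucl_cball x0 rho ->
  (forall n, exists (I : finType) (z : I -> 'rV[R]_d),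
    [/\ forall i, F (z i),
      forall i j, i != j -> (b ^+ n)^-1 / 2 < eucl_dist (z i) (z j) &
      c * g ^+ n <= #|I|%:R]) ->
  assouad_exponent F alpha -> g <= b `^ alpha.
Proof.
move=> b1 c0 rho1 Fx0 Frho sep [alpha0 [C [C0 hC]]].
rewrite leNgt; apply/negP => gb.
have b0 : 0 < b by lra.
have ba0 : 0 < b `^ alpha by rewrite powR_gt0.
have q1 : 1 < g / b `^ alpha by rewrite ltr_pdivlMr// mul1r.
have [n] := exists_expr_gt (C * (2 * rho) `^ alpha / c) q1.
rewrite ltr_pdivrMr// expr_div_n mulrAC ltr_pdivlMr ?exprn_gt0//.
rewrite ltNge [_ * c]mulrC => /negP[].
have [I [z [zF zr zn]]] := sep n; apply: (le_trans zn).
have bn0 : 0 < b ^+ n by rewrite exprn_gt0.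
have r0 : 0 < (b ^+ n)^-1 / 2 by rewrite divr_gt0// invr_gt0.
have rr : (b ^+ n)^-1 / 2 < rho.
  have : (b ^+ n)^-1 <= 1 by rewrite invf_le1// exprn_ege1// ltW.
  lra.
have : ((#|I|%:R : R)%:E <=
    covering_number ((b ^+ n)^-1 / 2) (eucl_cball x0 rho `&` F))%E.
  apply: le_ereal_inf_tmp => _ [k hk <-]; rewrite lee_fin ler_nat.
  by apply: (leq_card_separated _ zr hk) => i; split; [exact: Frho|].
move=> /le_trans/(_ (hC _ _ _ r0 rr Fx0)); rewrite lee_fin => /le_trans; apply.
rewrite -mulrA (ler_pM2l C0).
rewrite (_ : rho / _ = 2 * rho * b ^+ n); last by field; rewrite gt_eqF.
rewrite powRM; [|lra|exact: ltW].
rewrite -(powR_mulrn n (ltW b0)) -(powR_mulrn n (ltW ba0)).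
by rewrite -!powRrM [alpha * _]mulrC.
Qed.

Lemma assouad_dim_separated_ge (F : set 'rV[R]_d) (b g c rho : R) x0 :
  1 < b -> 0 < c -> 0 < g -> 1 <= rho -> F x0 -> F `<=` eucl_cball x0 rho ->
  (forall n, exists (I : finType) (z : I -> 'rV[R]_d),
    [/\ forall i, F (z i),
      forall i j, i != j -> (b ^+ n)^-1 / 2 < eucl_dist (z i) (z j) &
      c * g ^+ n <= #|I|%:R]) ->
  ((ln g / ln b)%:E <= assouad_dim F)%E.
Proof.
move=> b1 c0 g0 rho1 Fx0 Frho sep.
apply: le_ereal_inf_tmp => _ [alpha halpha <-]; rewrite lee_fin.
have h := assouad_exponent_separated b1 c0 rho1 Fx0 Frho sep halpha.
rewrite ler_pdivrMr ?ln_gt0// -ln_powR ler_ln ?posrE//.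
exact: lt_le_trans h.
Qed.

(** Only exponents strictly above [beta] are asked for, which leaves room for a logarithmic
    factor. *)
Lemma assouad_dim_le (F : set 'rV[R]_d) (beta : R) :
  (forall alpha, beta < alpha -> assouad_exponent F alpha) ->
  (assouad_dim F <= beta%:E)%E.
Proof.
move=> h; apply/lee_addgt0Pr => e e0; apply: ereal_inf_lbound.
by exists (beta + e) => //; apply: h; rewrite ltrDl.
Qed.

End covering.

(** * The graph as a planar set *)

Section takagi_graph_dimension.
Context (R : realType) (a : R) (b : nat).
Hypotheses (a_ge0 : 0 <= a) (a_lt1 : a < 1) (b_ge2 : (2 <= b)%N).
Local Notation T := (takagi a b).
Local Notation graph := (takagi_graph a b).

Definition takagi_point (x : R) : 'rV[R]_2 := \row_(j < 2) [:: x; T x]`_j.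

Local Notation pt := takagi_point.

Lemma takagi_point_in x : 0 <= x <= 1 -> graph (pt x).
Proof. by move=> hx; exists x => //=; rewrite in_itv. Qed.

Lemma takagi_graphP p : graph p -> exists2 x, 0 <= x <= 1 & p = pt x.
Proof. by move=> [x /=]; rewrite in_itv => hx <-; exists x. Qed.

Lemma takagi_point_dist_le x y : eucl_dist (pt x) (pt y) <= `|x - y| + `|T x - T y|.
Proof.
apply: (le_trans (eucl_dist_le_sum _ _)).
by rewrite !big_ord_recl big_ord0 !mxE/= addr0.
Qed.

Lemma takagi_point_dist_ge_l x y : `|x - y| <= eucl_dist (pt x) (pt y).
Proof. by have := eucl_dist_ge_coord (pt x) (pt y) ord0; rewrite !mxE. Qed.

Lemma takagi_point_dist_ge_r x y : `|T x - T y| <= eucl_dist (pt x) (pt y).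
Proof. by have := eucl_dist_ge_coord (pt x) (pt y) ord_max; rewrite !mxE. Qed.

Let bR2 : (2 : R) <= b%:R. Proof. by rewrite ler_nat. Qed.

Let bn_gt0 n : (0 : R) < b%:R ^+ n.
Proof. by rewrite exprn_gt0//; have := bR2; lra. Qed.

Lemma takagi_graph_bounded : graph `<=` eucl_cball (pt 0) (1 + 2^-1 / (1 - a)).
Proof.
move=> _ /takagi_graphP[x hx ->]; apply: (le_trans (takagi_point_dist_le _ _)).
apply: lerD; last exact: takagi_dist_le.
by rewrite sub0r normrN ger0_norm; lra.
Qed.

(** * Lower bounds for the dimension of the graph *)

Lemma takagi_graph_separated (g c : R) : 0 < g -> 0 < c ->
  (forall n, exists (I : finType) (z : I -> R),
    [/\ forall i, 0 <= z i <= 1,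
      forall i j, i != j -> 1 <= b%:R ^+ n * `|z i - z j| \/
                            1 <= b%:R ^+ n * `|T (z i) - T (z j)| &
      c * g ^+ n <= #|I|%:R]) ->
  ((ln g / ln b%:R)%:E <= assouad_dim graph)%E.
Proof.
move=> g0 c0 h; have h0 : 0 <= (0 : R) <= 1 by rewrite lexx ler01.
apply: (@assouad_dim_separated_ge _ _ _ _ _ c (1 + 2^-1 / (1 - a)) (pt 0)) => //.
- by have := bR2; lra.
- by rewrite lerDl divr_ge0// subr_ge0 ltW.
- exact: takagi_point_in.
- exact: takagi_graph_bounded.
move=> n; have [I [z [z01 zs hI]]] := h n; exists I, (pt \o z).
split=> // [i|i j ij].
  exact/takagi_point_in.
have bn := bn_gt0 n.
have ibn : 0 < (b%:R ^+ n)^-1 :> R by rewrite invr_gt0.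
have : (b%:R ^+ n)^-1 <= eucl_dist (pt (z i)) (pt (z j)).
  rewrite -[_^-1]mul1r ler_pdivrMr// mulrC.
  have hl := takagi_point_dist_ge_l (z i) (z j).
  have hr := takagi_point_dist_ge_r (z i) (z j).
  by case: (zs i j ij) => /le_trans; apply; rewrite ler_pM2l.
rewrite /=; lra.
Qed.

Lemma assouad_dim_takagi_ge1 : (1%:E <= assouad_dim graph)%E.
Proof.
have -> : 1 = ln (b%:R : R) / ln b%:R.
  by rewrite divff// gt_eqF// ln_gt0//; have := bR2; lra.
apply: (@takagi_graph_separated _ 1) => //; first by have := bR2; lra.
move=> n; exists 'I_(b ^ n), (fun i : 'I_(b ^ n) => (i : nat)%:R / b%:R ^+ n).
split=> [i|i j ij|].
- apply/andP; split; first exact: divr_ge0 (ler0n _ _) (ltW (bn_gt0 n)).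
  by rewrite ler_pdivrMr// mul1r -natrX ler_nat ltnW.
- left; rewrite -mulrBl normrM [`|_^-1|]gtr0_norm ?invr_gt0// mulrCA divff ?gt_eqF//.
  by rewrite mulr1; exact: ler_nat_dist1.
- by rewrite card_ord mul1r natrX.
Qed.

(** By [takagi_mid] the value at the midpoint exceeds that at one of the end points by at least a^n
    / 2. That end point supplies [v0], and the intermediate value theorem applies on its half. *)
Lemma takagi_ivt n (j : int) : exists v0 : R, forall v,
  v0 <= v <= v0 + a ^+ n / 2 ->
  exists2 x, j%:~R <= b%:R ^+ n * x <= j%:~R + 1 & T x = v.
Proof.
have bn := bn_gt0 n; have b0 : (0 < b)%N by lia.
pose x : R := j%:~R / b%:R ^+ n; pose y : R := (j%:~R + 1) / b%:R ^+ n.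
have hx : b%:R ^+ n * x = j%:~R by rewrite mulrC divfK// gt_eqF.
have hy : b%:R ^+ n * y = j%:~R + 1 by rewrite mulrC divfK// gt_eqF.
have xy : x <= y by rewrite ler_pM2r ?invr_gt0//; lra.
have mid := takagi_mid a_ge0 a_lt1 b0 hx hy.
have cT u v : {within `[u, v], continuous T}.
  exact/continuous_subspaceT/takagi_continuous.
have sub c : x <= c <= y -> j%:~R <= b%:R ^+ n * c <= j%:~R + 1.
  by move=> /andP[xc cy]; rewrite -hy -hx !ler_pM2l// xc.
pose m := (x + y) / 2.
have [hT|hT] := lerP (T x + a ^+ n / 2) (T m).
  exists (T x) => v hv; have xm : x <= m by rewrite /m; lra.
  have [|c] := IVT xm (cT x m) (v := v).
    by rewrite ge_min le_max; lra.
  by rewrite in_itv => /= hc <-; exists c => //; apply: sub; rewrite /m in hc; lra.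
exists (T y) => v hv; have my : m <= y by rewrite /m; lra.
have [|c] := IVT my (cT m y) (v := v).
  by rewrite ge_min le_max; rewrite -/m in mid; lra.
by rewrite in_itv => /= hc <-; exists c => //; apply: sub; rewrite /m in hc; lra.
Qed.

Lemma assouad_dim_takagi_gt1 : 1 < a * b%:R -> (1%:E < assouad_dim graph)%E.
Proof.
move=> ab1; have b1 : (1 : R) < b%:R by have := bR2; lra.
have ab2 : b%:R < a * b%:R ^+ 2 by rewrite expr2 mulrA ltr_pMl//; lra.
apply: (@lt_le_trans _ _ (ln (a * b%:R ^+ 2) / ln b%:R)%:E).
  by rewrite lte_fin ltr_pdivlMr ?ln_gt0// mul1r ltr_ln ?posrE//; lra.
apply: (@takagi_graph_separated _ 4^-1); [lra|lra|].
(* [P] counts the even cell numbers below b^n. [K] is one more than an integer part, so that each k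
   < K satisfies k b^-n <= a^n / 2 while [K] still exceeds a^n b^n / 2. *)
move=> n; set P := ((b ^ n).+1./2)%N.
set K := (Num.trunc (a ^+ n * b%:R ^+ n / 2)).+1.
have bn := bn_gt0 n.
have an : 0 <= a ^+ n * b%:R ^+ n / 2.
  by rewrite divr_ge0// mulr_ge0 ?exprn_ge0// ltW.
have /andP[K1 K2] := truncn_itv an.
(* Points are indexed by an even cell and a height in steps of b^-n. [xget] makes the base height
   depend on the cell alone, so heights within a cell are comparable; its default 0 is excluded by
   [takagi_ivt]. *)
have /choice[z hz] : forall ik : 'I_P * 'I_K, exists x : R,
   (2 * ik.1)%:R <= b%:R ^+ n * x <= (2 * ik.1)%:R + 1 /\
   T x = xget 0 [set v0 | forall v,
  v0 <= v <= v0 + a ^+ n / 2 ->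
  exists2 x, (2 * ik.1)%:R <= b%:R ^+ n * x <= (2 * ik.1)%:R + 1 & T x = v]
    + ik.2%:R / b%:R ^+ n.
  move=> [i k] /=; case: xgetP => [v0 _ hv0|]; last first.
    by have [v0 hv0] := takagi_ivt n (2 * i)%N%:Z => /(_ v0).
  have [|x hx xv] := hv0 (v0 + k%:R / b%:R ^+ n); last by exists x.
  rewrite lerDl lerD2l (divr_ge0 (ler0n _ _) (ltW bn))/= ler_pdivrMr// mulrAC.
  by apply: le_trans K1; rewrite ler_nat -ltnS.
exists ('I_P * 'I_K)%type, z; split=> [[i k]|[i k] [i' k'] ij|].
- have [/= /andP[h1 h2] _] := hz (i, k); apply/andP; split.
    by rewrite -(pmulr_rge0 _ bn); apply: le_trans h1; rewrite ler0n.
  rewrite -(ler_pM2l bn) mulr1; apply: (le_trans h2).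
  by rewrite natr1 -natrX ler_nat; exact: ltn_uphalf (ltn_ord i).
- have [/= h1 T1] := hz (i, k); have [/= h2 T2] := hz (i', k').
  (* Points over the same cell are separated by ordinate, points over different cells by
     abscissa. *)
  have [ii|ii] := eqVneq i i'.
    right; move: ij T2; rewrite -ii xpair_eqE eqxx/= T1 => kk ->.
    rewrite opprD addrACA subrr add0r -mulrBl normrM [`|_^-1|]gtr0_norm ?invr_gt0//.
    by rewrite mulrCA divff ?gt_eqF// mulr1; exact: ler_nat_dist1.
  left; rewrite -[b%:R ^+ n](gtr0_norm bn) -normrM mulrBr.
  have : (i != i' :> nat) by []; rewrite neq_ltn => /orP[] /(ler_double R) lt.
    by rewrite ler_normr; lra.
  by rewrite ler_normr; lra.
rewrite card_prod !card_ord natrM.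
have P1 : b%:R ^+ n / 2 <= P%:R :> R.
  by rewrite -natrX; exact: half_le_uphalf.
rewrite exprMn -exprM mulnC exprM expr2.
rewrite (_ : _ * _ = (b%:R ^+ n / 2) * (a ^+ n * b%:R ^+ n / 2)); last by field.
by apply: ler_pM => //; exact: ltW.
Qed.

(** * Upper bound for the dimension when a b <= 1 *)

(* The ball meets boundedly many cells of level [n], where [b ^ n ~ 1 / rho].
   Over a cell of slope [s] its width is [O(rho / (1 + |s|))]; cut into columns of
   width [~ r / (1 + |s|)], this makes the number of columns [O(rho / r)] and the
   height of a column [O((1 + m) r)], both uniformly in [s]. *)
Lemma takagi_graph_cover (r rho x0 : R) : a <= b%:R^-1 -> 0 < r -> r < rho ->
  exists m N : nat,
    [/\ b%:R ^+ m <= b%:R * (rho / r),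
      has_open_cover r (eucl_cball (pt x0) rho `&` graph) N &
      N%:R <= 83 * (16 * b%:R + 5) * (rho / r) * (2 * m%:R + 19)].
Proof.
move=> ab r0 rrho; have rho0 : 0 < rho by lra.
have b1 : (1 : R) < b%:R by have := bR2; lra.
have t1 : 1 < rho / r by rewrite ltr_pdivlMr// mul1r.
(* The cell level [n] is matched to the radius and [m] to the ratio of scales, so that b^-n <= rho
   and b^-(n + m) <= r. *)
have [n [n1 n2]] := @expr_bracket R b%:R rho^-1 b1 ltac:(by rewrite invr_gt0).
have [m [m1 m2]] := @expr_bracket R b%:R (rho / r) b1 ltac:(by lra).
have bm : b%:R ^+ m <= b%:R * (rho / r).
  by case: m2 => [->|/ltW//]; rewrite expr0; nra.
have bn := bn_gt0 n.
have ibn : (b%:R ^+ n)^-1 <= rho by rewrite invf_ple ?posrE.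
have ibnm : b%:R^-1 ^+ (n + m) <= r.
  rewrite exprVn exprD invfM -[r](divfK (_ : rho != 0)) ?gt_eqF// mulrC.
  apply: ler_pM => //; rewrite ?invr_ge0 ?(ltW (bn_gt0 _))//.
  by rewrite invf_ple ?posrE ?bn_gt0 ?divr_gt0// invf_div.
set N2 := (Num.trunc (40 * (rho / r))).+1.
have t40 : 0 <= 40 * (rho / r) by lra.
have /andP[N2a N2b] := truncn_itv t40.
(* The factors count half-cells, columns, pieces of a column, and one open set per piece. *)
exists m, ((2 * (8 * b + 2)).+1 * ((2 * N2).+1 * ((2 * (9 + m)).+1 * 1)))%N.
split=> //; last first.
  have -> : ((2 * (8 * b + 2)).+1 * ((2 * N2).+1 * ((2 * (9 + m)).+1 * 1)))%:R =
      (16 * b%:R + 5) * (2 * N2%:R + 1) * (2 * m%:R + 19) :> R.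
    rewrite muln1 -(addn1 (2 * (8 * b + 2))) -(addn1 (2 * N2)).
    by rewrite -(addn1 (2 * (9 + m))) !(natrM, natrD); ring.
  (* The left side is at most 80 rho / r + 3, and rho / r > 1. *)
  have N2t : 2 * N2%:R + 1 <= 83 * (rho / r) by rewrite /N2 -natr1; lra.
  by rewrite ler_wpM2r// [leRHS]mulrAC [leRHS]mulrC ler_wpM2l//.
pose X (p : 'rV[R]_2) := p ord0 ord0; pose Y (p : 'rV[R]_2) := p ord0 ord_max.
have gr p : graph p -> 0 <= X p <= 1 /\ Y p = T (X p).
  by move=> /takagi_graphP[x hx ->]; rewrite /X /Y !mxE.
pose f p : R := (Num.floor (2 * (b%:R ^+ n * X p)))%:~R.
have hf p : f p <= 2 * (b%:R ^+ n * X p) < f p + 1.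
  by have := floor_itv (2 * (b%:R ^+ n * X p)); rewrite intrD.
(* Integers within 1/2 of each other are equal, so each slice lies over one half-cell. In the ball
   [f] varies by at most 4 b + 1, that is 8 b + 2 steps. *)
apply: (@has_open_cover_slices _ _ _ 2^-1 _ f); first lra.
  move=> p q [pc /gr[pX _]] [qc /gr[qX _]].
  have pX0 := le_trans (eucl_dist_ge_coord _ _ ord0) pc.
  have qX0 := le_trans (eucl_dist_ge_coord _ _ ord0) qc.
  have d1 : `|X p - X q| <= 1 by rewrite ler_norml; lra.
  have d2 : `|X p - X q| <= 2 * rho.
    by move: pX0 qX0; rewrite -/(X p) -/(X q) !ler_norml; lra.
  have d3 : b%:R ^+ n * `|X p - X q| <= 2 * b%:R.
    case: n2 => [->|n2]; first by rewrite expr0 mul1r; lra.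
    apply: (@le_trans _ _ (b%:R ^+ n * (2 * rho))); first by rewrite ler_pM2l.
    by move: n2; rewrite ltr_pdivlMr// => n2; lra.
  move: d3; rewrite -[b%:R ^+ n](gtr0_norm bn) -normrM mulrBr ler_norml => d3.
  by have := hf p; have := hf q; rewrite natrD natrM ler_norml; lra.
move=> E1 E1s E1f; have [->|/set0P[p1 Ep1]] := eqVneq E1 set0.
  exact: has_open_cover0.
pose j := Num.floor (2 * (b%:R ^+ n * X p1)).
have fj p : E1 p -> Num.floor (2 * (b%:R ^+ n * X p)) = j.
  move=> Ep; apply/eqP; rewrite -subr_eq0; apply/eqP/(intr_norm_lt1 (R := R)).
  by have := E1f _ _ Ep Ep1; rewrite /f -/j intrB; lra.
have [s hs] := takagi_cell a_ge0 a_lt1 n j b_ge2 ab.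
have {}hs k p q : E1 p -> E1 q ->
    `|Y p - Y q - s * (X p - X q)| <= k%:R * `|X p - X q| + b%:R^-1 ^+ (n + k).
  move=> Ep Eq; have [_ /gr[_ ->]] := E1s _ Ep; have [_ /gr[_ ->]] := E1s _ Eq.
  by apply: hs; exact: fj.
pose M := 1 + `|s|; have M1 : 1 <= M by rewrite lerDl.
(* With this width, the horizontal extent and the rise due to the slope add up to r / 8. *)
pose w := r / (8 * M).
have wM : `|s| * w + w = r / 8 by rewrite /w /M; field; rewrite gt_eqF.
have w0 : 0 < w by rewrite divr_gt0//; lra.
apply: (@has_open_cover_slices _ _ _ w _ X) => //.
  move=> p q Ep Eq; have [pc _] := E1s _ Ep; have [qc _] := E1s _ Eq.
  have pX0 := le_trans (eucl_dist_ge_coord _ _ ord0) pc.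
  have qX0 := le_trans (eucl_dist_ge_coord _ _ ord0) qc.
  have pY0 := le_trans (eucl_dist_ge_coord _ _ ord_max) pc.
  have qY0 := le_trans (eucl_dist_ge_coord _ _ ord_max) qc.
  have dX : `|X p - X q| <= 2 * rho.
    by move: pX0 qX0; rewrite -/(X p) -/(X q) !ler_norml; lra.
  have dY : `|Y p - Y q| <= 2 * rho.
    by move: pY0 qY0; rewrite -/(Y p) -/(Y q) !ler_norml; lra.
  (* Take k = 0 in [hs]: the height 2 rho of the ball plus the error b^-n <= rho controls the rise.
     Adding the width gives 5 rho, the source of 40 in [N2]. *)
  have sX : `|s| * `|X p - X q| <= 3 * rho.
    have := hs 0%N _ _ Ep Eq; rewrite mul0r add0r addn0 exprVn -normrM.
    by move: dY; rewrite !ler_norml; lra.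
  apply: (@le_trans _ _ (5 * rho / M)).
    by rewrite ler_pdivlMr; [rewrite /M; lra|lra].
  rewrite (_ : 5 * rho / M = 40 * (rho / r) * w).
    by rewrite ler_wpM2r ?ltW.
  by rewrite /w; field; rewrite gt_eqF//=; lra.
move=> E2 E2s E2X.
apply: (@has_open_cover_slices _ _ _ (r / 8) _ Y); first by rewrite divr_gt0.
  (* The column height is at most r / 8 for the slope, m r / 8 for the Lipschitz term and r for the
     tail: 9 + m steps of r / 8. *)
  move=> p q Ep Eq; have := hs m _ _ (E2s _ Ep) (E2s _ Eq).
  have dX := E2X _ _ Ep Eq.
  have h1 : `|s * (X p - X q)| <= `|s| * w by rewrite normrM ler_wpM2l.
  have h2 : m%:R * `|X p - X q| <= m%:R * (r / 8).
    rewrite ler_wpM2l//; apply: (le_trans dX); rewrite -wM lerDr.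
    by rewrite mulr_ge0// ltW.
  have h3 : `|s| * w <= r / 8 by lra.
  by move: h1; rewrite natrD !ler_norml; lra.
move=> E3 E3s E3Y; apply: has_open_cover1 => // p q Ep Eq.
rewrite !big_ord_recl big_ord0 addr0.
have -> : lift ord0 ord0 = ord_max :> 'I_2 by apply: val_inj.
have := E2X _ _ (E3s _ Ep) (E3s _ Eq); have := E3Y _ _ Ep Eq.
have : 0 <= `|s| * w by rewrite mulr_ge0// ltW.
by rewrite /X /Y; lra.
Qed.

Lemma assouad_dim_takagi_le1 : a <= b%:R^-1 -> (assouad_dim graph <= 1%:E)%E.
Proof.
move=> ab; apply: assouad_dim_le => alpha alpha1; split; first lra.
have b1 : (1 : R) < b%:R by have := bR2; lra.
have [C C0 hC] := @log_le_powR R b%:R (alpha - 1) b1 ltac:(by lra).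
have K0 : 0 < 83 * (16 * b%:R + 5) :> R by lra.
exists (83 * (16 * b%:R + 5) * C); split; first exact: mulr_gt0.
move=> r rho _ r0 rrho /takagi_graphP[x _ ->].
have t1 : 1 < rho / r by rewrite ltr_pdivlMr// mul1r.
have [m [N [bm cov NC]]] := takagi_graph_cover x ab r0 rrho.
apply: (le_trans (covering_number_le cov)); rewrite lee_fin; apply: (le_trans NC).
(* One factor rho / r comes from the cover; the remaining power alpha - 1 > 0 absorbs the
   logarithm. *)
rewrite -(mulr_powRB1 (x := rho / r) (p := alpha)); [|lra|lra].
set K := 83 * (16 * b%:R + 5) in K0 *; set t := rho / r in t1 bm *.
rewrite (_ : K * C * (t * t `^ (alpha - 1)) = K * t * (C * t `^ (alpha - 1))).
  have t0 : 0 < t by lra.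
  by rewrite (ler_pM2l (mulr_gt0 K0 t0)); exact: hC.
by rewrite mulrACA.
Qed.

End takagi_graph_dimension.

Theorem corollary1p3 (R : realType) (b : nat) (hb : (2 <= b)%N)
    (a : R) (ha0 : 0 <= a) (ha1 : a < 1) :
  assouad_dim (takagi_graph a b) = 1%E <-> 0 <= a <= (b%:R : R)^-1.
Proof.
have b0 : (0 : R) < b%:R by rewrite ltr0n; lia.
rewrite ha0/=; split=> [dim1|ab].
  rewrite leNgt; apply/negP; rewrite -[_^-1]mul1r ltr_pdivrMr// => ab.
  by have := assouad_dim_takagi_gt1 ha0 ha1 hb ab; rewrite dim1 ltxx.
apply/eqP; rewrite eq_le assouad_dim_takagi_le1//=.
exact: assouad_dim_takagi_ge1.
Qed.
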